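(* Let $\{\mathbf t_1,\mathbf t_2,\mathbf n\}$ be an orthonormal basis of $\mathbb R^3$ and let $\mathbf F\in\mathbb R^{3\times3}_+$. Let $W:\mathbb R^{3\times3}_+\to\mathbb R$ be continuous, frame-indifferent and satisfy $W(\mathbf F)\to\infty$ as $\det\mathbf F\to0$ or $|\mathbf F|\to\infty$. Let $W_{\mathrm d}$ be the effective energy associated with $W$, defined in the context. Then: a) $W_{\mathrm d}(\mathbf F,\mathbf n)$ does not depend on $\mathbf t_1,\mathbf t_2$. b) $W_{\mathrm d}(\mathbf F,\mathbf n)=W_{\mathrm d}(\mathbf F,-\mathbf n)$. c) $W_{\mathrm d}(\mathbf Q\mathbf F,\mathbf n)=W_{\mathrm d}(\mathbf F,\mathbf n)$ for all $\mathbf Q\in SO(3)$. d) If $\mathcal S\subset SO(3)$ is the group of symmetries of $W$, then $W_{\mathrm d}(\mathbf F\mathbf Q^T,\mathbf Q\mathbf n)=W_{\mathrm d}(\mathbf F,\mathbf n)$ for all $\mathbf Q\in\mathcal S$. e) If $W$ is isotropic, then $W_{\mathrm d}(\mathbf F\mathbf Q^T,\mathbf Q\mathbf n)=W_{\mathrm d}(\mathbf F,\mathbf n)$ for all $\mathbf Q\in SO(3)$.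
   Context: $\mathbb R^{3\times3}_+$ is the set of real $3\times3$ matrices with positive determinant; $SO(3)$ its subset of rotations; $|\mathbf F|=(\sum_{ij}F_{ij}^2)^{1/2}$; $(\mathbf a\otimes\mathbf b)_{ij}=a_ib_j$. $W$ is frame-indifferent if $W(\mathbf R\mathbf F)=W(\mathbf F)$ for all $\mathbf F\in\mathbb R^{3\times3}_+$, $\mathbf R\in SO(3)$. The group $\mathcal S$ of symmetries of $W$ is the set of $\mathbf Q\in SO(3)$ such that $W(\mathbf F\mathbf Q)=W(\mathbf F)$ for all $\mathbf F\in\mathbb R^{3\times3}_+$; $W$ is isotropic if $\mathcal S=SO(3)$. The condition ''$W(\mathbf F)\to\infty$ as $\det\mathbf F\to0$ or $|\mathbf F|\to\infty$'' means $W(\mathbf F_j)\to\infty$ along every sequence in $\mathbb R^{3\times3}_+$ with $\det\mathbf F_j\to0$ and along every sequence in $\mathbb R^{3\times3}_+$ with $|\mathbf F_j|\to\infty$. For an orthonormal basis $\{\mathbf t_1,\mathbf t_2,\mathbf n\}$ of $\mathbb R^3$ and numbers $A_{\mathbf n\mathbf n}, A_{\mathbf t_1\mathbf t_1}, A_{\mathbf t_2\mathbf t_2}>0$, $A_{\mathbf t_1\mathbf n}, A_{\mathbf t_2\mathbf n}, A_{\mathbf t_1\mathbf t_2}\in\mathbb R$, define $$\mathbf A_{\mathbf t_1,\mathbf t_2,\mathbf n}(A_{\mathbf n\mathbf n}, A_{\mathbf t_1\mathbf t_1}, A_{\mathbf t_2\mathbf t_2}, A_{\mathbf t_1\mathbf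 n}, A_{\mathbf t_2\mathbf n}, A_{\mathbf t_1\mathbf t_2}) := A_{\mathbf n\mathbf n}\,\mathbf n\otimes\mathbf n + A_{\mathbf t_1\mathbf t_1}\,\mathbf t_1\otimes\mathbf t_1 + A_{\mathbf t_2\mathbf t_2}\,\mathbf t_2\otimes\mathbf t_2 + A_{\mathbf t_1\mathbf n}\,\mathbf t_1\otimes\mathbf n + A_{\mathbf t_2\mathbf n}\,\mathbf t_2\otimes\mathbf n + A_{\mathbf t_1\mathbf t_2}\,\mathbf t_1\otimes\mathbf t_2 .$$ QR decomposition: every $\mathbf F\in\mathbb R^{3\times3}_+$ can be written uniquely as $\mathbf F=\mathbf R\mathbf A$ with $\mathbf R\in SO(3)$ and $\mathbf A=\mathbf A_{\mathbf t_1,\mathbf t_2,\mathbf n}(A_{\mathbf n\mathbf n}, A_{\mathbf t_1\mathbf t_1}, A_{\mathbf t_2\mathbf t_2}, A_{\mathbf t_1\mathbf n}, A_{\mathbf t_2\mathbf n}, A_{\mathbf t_1\mathbf t_2})$, where $A_{\mathbf n\mathbf n}, A_{\mathbf t_1\mathbf t_1}, A_{\mathbf t_2\mathbf t_2}>0$ and $A_{\mathbf t_1\mathbf n}, A_{\mathbf t_2\mathbf n}, A_{\mathbf t_1\mathbf t_2}\in\mathbb R$. Definition of $A^*_{\mathbf n\mathbf n}$: with $A_{\mathbf t_1\mathbf t_1}, A_{\mathbf t_2\mathbf t_2}, A_{\mathbf t_1\mathbf t_2}$ the coefficients from the QR decomposition of $\mathbf F$, $A^*_{\mathbf n\mathbf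 n}$ is the least $\bar A_{\mathbf n\mathbf n}>0$ for which there exist $A^*_{\mathbf t_1\mathbf n},A^*_{\mathbf t_2\mathbf n}\in\mathbb R$ such that $(\bar A_{\mathbf n\mathbf n},A^*_{\mathbf t_1\mathbf n},A^*_{\mathbf t_2\mathbf n})$ minimizes $(A'_{\mathbf n\mathbf n},A'_{\mathbf t_1\mathbf n},A'_{\mathbf t_2\mathbf n})\mapsto W(\mathbf A_{\mathbf t_1,\mathbf t_2,\mathbf n}(A'_{\mathbf n\mathbf n}, A_{\mathbf t_1\mathbf t_1}, A_{\mathbf t_2\mathbf t_2}, A'_{\mathbf t_1\mathbf n}, A'_{\mathbf t_2\mathbf n}, A_{\mathbf t_1\mathbf t_2}))$ over $(0,\infty)\times\mathbb R\times\mathbb R$ (under the stated assumptions on $W$ this least value and the minima below exist). Definition of the effective energy $W_{\mathrm d}$ (computed using an orthonormal basis $\{\mathbf t_1,\mathbf t_2,\mathbf n\}$ whose last vector is the second argument $\mathbf n$; part a) asserts that the value is the same for every choice of $\mathbf t_1,\mathbf t_2$ completing $\mathbf n$ to an orthonormal basis): $$W_{\mathrm d}(\mathbf F,\mathbf n)=\begin{cases}\displaystyle\min_{\substack{A'_{\mathbf n\mathbf n}>0 \\ A'_{\mathbf t_1\mathbf n},A'_{\mathbf t_2\mathbf n}\in\mathbb R}}W\left(\mathbf A_{\mathbf t_1,\mathbf t_2,\mathbf n}(A'_{\mathbf n\mathbf n}, A_{\mathbf t_1\mathbf t_1}, A_{\mathbf t_2\mathbf t_2}, A'_{\mathbf t_1\mathbf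 n}, A'_{\mathbf t_2\mathbf n}, A_{\mathbf t_1\mathbf t_2})\right),&\text{if }A_{\mathbf n\mathbf n}\ge A^*_{\mathbf n\mathbf n},\\[2ex] \displaystyle\min_{A'_{\mathbf t_1\mathbf n},A'_{\mathbf t_2\mathbf n}\in\mathbb R}W\left(\mathbf A_{\mathbf t_1,\mathbf t_2,\mathbf n}(A_{\mathbf n\mathbf n}, A_{\mathbf t_1\mathbf t_1}, A_{\mathbf t_2\mathbf t_2}, A'_{\mathbf t_1\mathbf n}, A'_{\mathbf t_2\mathbf n}, A_{\mathbf t_1\mathbf t_2})\right),&\text{if }A_{\mathbf n\mathbf n}<A^*_{\mathbf n\mathbf n}.\end{cases}$$ *)

(* Defs.v *)
From HB Require Import structures.
From mathcomp Require Import all_boot all_order all_algebra.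
From mathcomp Require Import all_classical all_reals all_analysis.

Set Implicit Arguments.
Unset Strict Implicit.
Unset Printing Implicit Defensive.

Import Order.TTheory GRing.Theory Num.Theory.
Import numFieldNormedType.Exports.

Local Open Scope classical_set_scope.
Local Open Scope ring_scope.

(* Energies are total functions W : 'M[R]_3 -> R, of which only the values on
   GLplus R are ever constrained or used. *)
Definition GLplus (R : realType) : set 'M[R]_3 := [set F | 0 < \det F].

Definition SO3 (R : realType) : set 'M[R]_3 :=
  [set Q | Q^T *m Q = 1%:M /\ \det Q = 1].

Definition frobenius (R : realType) (F : 'M[R]_3) : R :=
  Num.sqrt (\sum_(i < 3) \sum_(j < 3) F i j ^+ 2).

Definition tensor (R : realType) (a b : 'cV[R]_3) : 'M[R]_3 := a *m b^T.

Definition dot (R : realType) (a b : 'cV[R]_3) : R := \sum_(i < 3) a i 0 * b i 0.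

(* Three orthonormal vectors automatically span R^3; no orientation is
   imposed. *)
Definition orthonormal_basis (R : realType) (t1 t2 n : 'cV[R]_3) : Prop :=
  [/\ dot t1 t1 = 1, dot t2 t2 = 1 & dot n n = 1] /\
  [/\ dot t1 t2 = 0, dot t1 n = 0 & dot t2 n = 0].

Definition frame_indifferent (R : realType) (W : 'M[R]_3 -> R) : Prop :=
  forall F Q : 'M[R]_3, GLplus F -> SO3 Q -> W (Q *m F) = W F.

Definition symmetries (R : realType) (W : 'M[R]_3 -> R) : set 'M[R]_3 :=
  [set Q | SO3 Q /\ forall F : 'M[R]_3, GLplus F -> W (F *m Q) = W F].

Definition isotropic (R : realType) (W : 'M[R]_3 -> R) : Prop :=
  symmetries W = @SO3 R.

Definition blows_up (R : realType) (W : 'M[R]_3 -> R) : Prop :=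
  (forall Fs : nat -> 'M[R]_3, (forall j, GLplus (Fs j)) ->
     \det (Fs j) @[j --> \oo] --> (0 : R) -> W (Fs j) @[j --> \oo] --> +oo) /\
  (forall Fs : nat -> 'M[R]_3, (forall j, GLplus (Fs j)) ->
     frobenius (Fs j) @[j --> \oo] --> +oo -> W (Fs j) @[j --> \oo] --> +oo).

Definition Amx (R : realType) (t1 t2 n : 'cV[R]_3)
    (Ann At1t1 At2t2 At1n At2n At1t2 : R) : 'M[R]_3 :=
  Ann *: tensor n n + At1t1 *: tensor t1 t1 + At2t2 *: tensor t2 t2
  + At1n *: tensor t1 n + At2n *: tensor t2 n + At1t2 *: tensor t1 t2.

Definition QR_decomposition (R : realType) (t1 t2 n : 'cV[R]_3)
    (F Q : 'M[R]_3) (Ann At1t1 At2t2 At1n At2n At1t2 : R) : Prop :=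
  [/\ SO3 Q, 0 < Ann, 0 < At1t1, 0 < At2t2 &
      F = Q *m Amx t1 t2 n Ann At1t1 At2t2 At1n At2n At1t2].

(* The least element of E, when there is one (an arbitrary real otherwise). *)
Definition least (R : realType) (E : set R) : R := get (E `&` lbound E).

Definition is_minimizer (R : realType) (W : 'M[R]_3 -> R) (t1 t2 n : 'cV[R]_3)
    (At1t1 At2t2 At1t2 : R) (Bnn Bt1n Bt2n : R) : Prop :=
  0 < Bnn /\
  forall Ann At1n At2n : R, 0 < Ann ->
    W (Amx t1 t2 n Bnn At1t1 At2t2 Bt1n Bt2n At1t2)
      <= W (Amx t1 t2 n Ann At1t1 At2t2 At1n At2n At1t2).

Definition Astar (R : realType) (W : 'M[R]_3 -> R) (t1 t2 n : 'cV[R]_3)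
    (At1t1 At2t2 At1t2 : R) : R :=
  least [set Bnn | exists Bt1n Bt2n : R,
           is_minimizer W t1 t2 n At1t1 At2t2 At1t2 Bnn Bt1n Bt2n].

Definition min_stretch_shear (R : realType) (W : 'M[R]_3 -> R)
    (t1 t2 n : 'cV[R]_3) (At1t1 At2t2 At1t2 : R) : R :=
  least [set w | exists Bnn Bt1n Bt2n : R, 0 < Bnn /\
           w = W (Amx t1 t2 n Bnn At1t1 At2t2 Bt1n Bt2n At1t2)].

Definition min_shear (R : realType) (W : 'M[R]_3 -> R)
    (t1 t2 n : 'cV[R]_3) (Ann At1t1 At2t2 At1t2 : R) : R :=
  least [set w | exists Bt1n Bt2n : R,
           w = W (Amx t1 t2 n Ann At1t1 At2t2 Bt1n Bt2n At1t2)].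

(* The effective energy W_d(F, n), computed in the basis (t1, t2, n).  For F in
   GLplus R the QR decomposition exists and is unique, so the set below is a
   singleton. *)
Definition Wd (R : realType) (W : 'M[R]_3 -> R) (t1 t2 : 'cV[R]_3)
    (F : 'M[R]_3) (n : 'cV[R]_3) : R :=
  get [set w | exists Q : 'M[R]_3,
         exists Ann At1t1 At2t2 At1n At2n At1t2 : R,
         QR_decomposition t1 t2 n F Q Ann At1t1 At2t2 At1n At2n At1t2 /\
         w = if Astar W t1 t2 n At1t1 At2t2 At1t2 <= Ann
             then min_stretch_shear W t1 t2 n At1t1 At2t2 At1t2
             else min_shear W t1 t2 n Ann At1t1 At2t2 At1t2].

(* Main.v *)
(* If F = Q A in the QR decomposition with respect to (t1, t2, n), then
   A^T n = A_nn n gives F^-T n = A_nn^-1 Q n, so A_nn = 1 / |F^-T n| depends on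
   F and n only.  Changing A_nn, A_t1n and A_t2n amounts to replacing F by
   F + v (x) n, where v ranges over the vectors with a prescribed component along
   F^-T n.  Hence, by frame indifference, W_d(F, n) is given by a formula in which
   t1, t2 and the decomposition do not occur, and this formula is equivariant
   under n -> - n, F -> Q F and (F, n) -> (F Q^T, Q n). *)

Require Import Defs.
From HB Require Import structures.
From mathcomp Require Import all_boot all_order all_algebra.
From mathcomp Require Import all_classical all_reals all_analysis.
From mathcomp Require Import ring.

Set Implicit Arguments.
Unset Strict Implicit.
Unset Printing Implicit Defensive.

Import Order.TTheory GRing.Theory Num.Theory.
Import numFieldNormedType.Exports.

Local Open Scope classical_set_scope.
Local Open Scope ring_scope.

Section EffectiveEnergy.
Variable R : realType.
Implicit Types (t n a b u v : 'cV[R]_3) (F G Q : 'M[R]_3) (W : 'M[R]_3 -> R).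

(** * Inner products, tensor products and rotations *)

Lemma dotE a b : dot a b = (a^T *m b) 0 0.
Proof. by rewrite mxE; apply: eq_bigr => i _; rewrite mxE. Qed.

Lemma dot_mx a b : a^T *m b = (dot a b)%:M.
Proof. by rewrite dotE [LHS]mx11_scalar. Qed.

Lemma dotC a b : dot a b = dot b a.
Proof. by apply: eq_bigr => i _; rewrite mulrC. Qed.

Lemma dotDr a b c : dot a (b + c) = dot a b + dot a c.
Proof. by rewrite !dotE mulmxDr mxE. Qed.

Lemma dotZr k a b : dot a (k *: b) = k * dot a b.
Proof. by rewrite !dotE -scalemxAr mxE. Qed.

Lemma dotZl k a b : dot (k *: a) b = k * dot a b.
Proof. by rewrite dotC dotZr dotC. Qed.

Lemma dot_adj (A : 'M[R]_3) a b : dot a (A *m b) = dot (A^T *m a) b.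
Proof. by rewrite !dotE trmx_mul trmxK mulmxA. Qed.

Lemma dot_ge0 a : 0 <= dot a a.
Proof. by apply: sumr_ge0 => i _; rewrite -expr2 sqr_ge0. Qed.

Lemma dot_eq0 a : dot a a = 0 -> a = 0.
Proof.
move=> a0; apply/matrixP => i j; rewrite ord1 mxE.
have /psumr_eq0P/(_ a0 i erefl) : forall k, true -> 0 <= a k 0 * a k 0.
  by move=> k _; rewrite -expr2 sqr_ge0.
by move/eqP; rewrite mulf_eq0 orbb => /eqP.
Qed.

Lemma tensor_mulv a b v : tensor a b *m v = dot b v *: a.
Proof. by rewrite /tensor -mulmxA dot_mx mul_mx_scalar. Qed.

Lemma mul_tensor (A : 'M[R]_3) a b : A *m tensor a b = tensor (A *m a) b.
Proof. by rewrite /tensor mulmxA. Qed.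

Lemma tensor_mul (A : 'M[R]_3) a b : tensor a b *m A = tensor a (A^T *m b).
Proof. by rewrite /tensor trmx_mul trmxK mulmxA. Qed.

Lemma tr_tensor a b : (tensor a b)^T = tensor b a.
Proof. by rewrite /tensor trmx_mul trmxK. Qed.

Lemma SO3_mulTr Q : SO3 Q -> Q *m Q^T = 1%:M.
Proof. by case=> /mulmx1C. Qed.

Lemma dot_SO3 Q a b : SO3 Q -> dot (Q *m a) (Q *m b) = dot a b.
Proof. by move=> SQ; rewrite dot_adj mulmxA SQ.1 mul1mx. Qed.

(** * Orthonormal bases and the algebra of [Amx] *)

Definition frame_mx t1 t2 n : 'M[R]_3 :=
  \matrix_(i, j) (if j == 0 then t1 else if j == 1 then t2 else n) i 0.

Lemma frame_mx_orthogonal t1 t2 n : orthonormal_basis t1 t2 n ->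
  (frame_mx t1 t2 n)^T *m frame_mx t1 t2 n = 1%:M.
Proof.
move=> [[h1 h2 h3] [h12 h13 h23]]; apply/matrixP => i j.
transitivity (dot (if i == 0 then t1 else if i == 1 then t2 else n)
                  (if j == 0 then t1 else if j == 1 then t2 else n)).
  by rewrite mxE; apply: eq_bigr => k _; rewrite !mxE.
rewrite mxE.
case: i => -[|[|[|i]]] //= ?; case: j => -[|[|[|j]]] //= ?;
  by rewrite ?h1 ?h2 ?h3 ?h12 ?h13 ?h23 // dotC ?h12 ?h13 ?h23.
Qed.

(** For the square matrix P with columns t1, t2, n, P^T P = 1 gives P P^T = 1, and expanding P P^T
    by columns yields this sum. *)
Lemma onb_resolution t1 t2 n : orthonormal_basis t1 t2 n ->
  tensor t1 t1 + tensor t2 t2 + tensor n n = 1%:M.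
Proof.
move=> /frame_mx_orthogonal/mulmx1C <-; apply/matrixP => i j.
by rewrite !mxE !big_ord_recl !big_ord0 !mxE /= !addr0 addrA.
Qed.

Lemma onb_expand t1 t2 n v : orthonormal_basis t1 t2 n ->
  v = dot t1 v *: t1 + dot t2 v *: t2 + dot n v *: n.
Proof.
by move=> /onb_resolution E; rewrite -{1}[v]mul1mx -E !mulmxDl !tensor_mulv.
Qed.

(** In the basis (t1, t2, n) the matrix is upper triangular with diagonal y, z, x. The orientation
    of the basis is irrelevant because det P det P^T = 1. *)
Lemma det_Amx t1 t2 n x y z p q r : orthonormal_basis t1 t2 n ->
  \det (Amx t1 t2 n x y z p q r) = x * y * z.
Proof.
move=> onb; set P := frame_mx t1 t2 n.
pose U : 'M[R]_3 := \matrix_(i, j)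
  nth 0 (nth [::] [:: [:: y; r; p]; [:: 0; z; q]; [:: 0; 0; x]] i) j.
have -> : Amx t1 t2 n x y z p q r = P *m U *m P^T.
  apply/matrixP => i j.
  do 6! rewrite ?mxE ?big_ord_recl ?big_ord0 /=.
  ring.
rewrite !det_mulmx mulrAC -det_mulmx.
have /mulmx1C -> := frame_mx_orthogonal onb.
rewrite det1 mul1r -det_tr det_trig.
  by rewrite !big_ord_recl big_ord0 !mxE /=; ring.
apply/is_trig_mxP => i j; rewrite !mxE.
by case: i => -[|[|[|i]]] //= ?; case: j => -[|[|[|j]]] //= ?.
Qed.

Lemma Amx_tr_mul_n t1 t2 n x y z p q r : orthonormal_basis t1 t2 n ->
  (Amx t1 t2 n x y z p q r)^T *m n = x *: n.
Proof.
move=> [[h1 h2 h3] [h12 h13 h23]].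
rewrite /Amx !linearD /= !linearZ /= !tr_tensor !mulmxDl -!scalemxAl !tensor_mulv.
by rewrite h3 h13 h23 !(scale0r, scaler0, addr0, add0r) scale1r.
Qed.

(** Varying the three coefficients over which the energy is minimized is a rank-one perturbation v
    (x) n. *)
Lemma Amx_shift t1 t2 n x y z p q r dx dp dq :
  Amx t1 t2 n (x + dx) y z (p + dp) (q + dq) r =
  Amx t1 t2 n x y z p q r + tensor (dp *: t1 + dq *: t2 + dx *: n) n.
Proof.
by apply/matrixP => i j; do 4! rewrite ?mxE ?big_ord_recl ?big_ord0 /=; ring.
Qed.

(** * The basis-free formula for the effective energy *)

(* [conormal F n] is [F^-T n]; when F = Q A, its direction is Q n and its norm is
   1 / A_nn, so [normal_stretch F n] is the coefficient A_nn. *)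
Definition conormal F n : 'cV[R]_3 := invmx F^T *m n.

Definition normal_stretch F n : R :=
  (Num.sqrt (dot (conormal F n) (conormal F n)))^-1.

(* The matrices Q A' where A' has the tangential coefficients of F and A'_nn = x
   (see [QR_fibre]). *)
Definition fibre F n x : set 'M[R]_3 :=
  [set G | 0 < \det G /\ exists2 v, G = F + tensor v n &
     normal_stretch F n * dot (conormal F n) v = x - normal_stretch F n].

(** [E x] stands for the energies attainable with normal stretch [x]. The first [least] ranges over
    the stretches at which the global minimum is attained, so it corresponds to A*_nn. *)
Definition reduced_energy (E : R -> set R) (h : R) : R :=
  if least [set x | 0 < x /\ exists2 w, E x w &
              forall y, 0 < y -> lbound (E y) w] <= h
  then least [set w | exists2 x, 0 < x & E x w]
  else least (E h).

(** Both branches evaluate [E] at positive stretches only, the range in which the fibres are later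
    compared with [Amx]. *)
Lemma eq_reduced_energy (E E' : R -> set R) h : 0 < h ->
  (forall x, 0 < x -> E x = E' x) -> reduced_energy E h = reduced_energy E' h.
Proof.
move=> h0 EE'; rewrite /reduced_energy EE' //.
have -> : [set x | 0 < x /\ exists2 w, E x w & forall y, 0 < y -> lbound (E y) w] =
    [set x | 0 < x /\ exists2 w, E' x w & forall y, 0 < y -> lbound (E' y) w].
  apply/seteqP; split=> x [x0 [w Ew lw]]; (split; first by []); exists w.
  - by rewrite -EE'.
  - by move=> y y0; rewrite -EE' //; exact: lw.
  - by rewrite EE'.
  - by move=> y y0; rewrite EE' //; exact: lw.
have -> // : [set w | exists2 x, 0 < x & E x w] = [set w | exists2 x, 0 < x & E' x w].
by apply/seteqP; split=> w [x x0 Ex]; exists x; rewrite // ?EE' // -EE'.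
Qed.

Definition intrinsic_Wd W F n : R :=
  reduced_energy (fun x => W @` fibre F n x) (normal_stretch F n).

Lemma GLplus_unit F : GLplus F -> F \in unitmx.
Proof. by move=> F0; rewrite unitmxE unitfE gt_eqF. Qed.

Lemma tr_mul_conormal F n : GLplus F -> F^T *m conormal F n = n.
Proof. by move=> /GLplus_unit uF; rewrite /conormal mulKVmx // unitmx_tr. Qed.

Lemma conormal_uniq F n u : GLplus F -> F^T *m u = n -> u = conormal F n.
Proof. by move=> /GLplus_unit uF <-; rewrite /conormal mulKmx // unitmx_tr. Qed.

(** The conormal cannot vanish, since F^T maps it to the unit vector n. *)
Lemma normal_stretch_gt0 F n : GLplus F -> dot n n = 1 -> 0 < normal_stretch F n.
Proof.
move=> F0 n1; rewrite invr_gt0 sqrtr_gt0 lt_neqAle dot_ge0 andbT eq_sym.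
apply/eqP => /dot_eq0 c0; move: n1; rewrite -(tr_mul_conormal n F0) c0 mulmx0.
by move/eqP; rewrite dotE mulmx0 mxE eq_sym oner_eq0.
Qed.

Lemma normal_stretch_sqr F n : GLplus F -> dot n n = 1 ->
  normal_stretch F n ^+ 2 * dot (conormal F n) (conormal F n) = 1.
Proof.
move=> F0 n1; have := normal_stretch_gt0 F0 n1; rewrite /normal_stretch => h0.
rewrite exprVn sqr_sqrtr ?dot_ge0 // mulVf //.
by apply: contraTneq h0 => ->; rewrite sqrtr0 invr0 ltxx.
Qed.

(** * Reading the basis-free formula in a given QR decomposition *)

Section Decomposition.
Variables (t1 t2 n : 'cV[R]_3) (F Q : 'M[R]_3) (x y z p q r : R).
Hypothesis onb : orthonormal_basis t1 t2 n.
Hypothesis F0 : GLplus F.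
Hypothesis QR : QR_decomposition t1 t2 n F Q x y z p q r.

(** F^T Q n = A^T Q^T Q n = A^T n = x n; applying F^-T gives the claim. *)
Lemma QR_mul_conormal : Q *m n = x *: conormal F n.
Proof.
have [SQ x0 _ _ FE] := QR.
have -> : conormal F n = x^-1 *: (Q *m n).
  apply/esym/conormal_uniq => //; rewrite FE trmx_mul -scalemxAr -!mulmxA.
  by rewrite (mulmxA Q^T) SQ.1 mul1mx Amx_tr_mul_n // scalerA mulVf ?scale1r ?gt_eqF.
by rewrite scalerA mulfV ?scale1r ?gt_eqF.
Qed.

(** Taking squared norms in [QR_mul_conormal] shows that two positive numbers have equal squares. *)
Lemma QR_stretch : x = normal_stretch F n.
Proof.
have [SQ x0 _ _ _] := QR; have n1 : dot n n = 1 by case: onb => -[].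
have h := normal_stretch_sqr F0 n1; have h0 := normal_stretch_gt0 F0 n1.
have := dot_SO3 n n SQ; rewrite QR_mul_conormal dotZl dotZr n1 mulrA -expr2 -h.
move/mulIf => E; apply/eqP; rewrite -(eqrXn2 (n := 2)) ?ltW //; apply/eqP/E.
by apply: contra_eq_neq h => ->; rewrite mulr0 eq_sym oner_eq0.
Qed.

(** Write the perturbation as v = Q u. The constraint on v fixes the n-component of u as x' - x,
    while its components along t1 and t2 are free and shift p and q. *)
Lemma QR_fibre x' : 0 < x' ->
  fibre F n x' =
  [set Q *m Amx t1 t2 n x' y z pq.1 pq.2 r | pq in [set: R * R]].
Proof.
have [SQ x0 y0 z0 FE] := QR => x'0; have [[h1 h2 h3] [h12 h13 h23]] := onb.
apply/seteqP; split=> [G [_ [v -> vE]]|_ [[p' q'] _ <-]].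
  exists (p + dot t1 (Q^T *m v), q + dot t2 (Q^T *m v)) => //=.
  have -> : x' = x + dot n (Q^T *m v).
    by rewrite dot_adj trmxK QR_mul_conormal QR_stretch dotZl vE addrC subrK.
  rewrite Amx_shift -onb_expand // mulmxDr -FE mul_tensor mulmxA.
  by rewrite SO3_mulTr // mul1mx.
split; first by rewrite det_mulmx SQ.2 mul1r det_Amx // !mulr_gt0.
pose u := (p' - p) *: t1 + (q' - q) *: t2 + (x' - x) *: n.
exists (Q *m u).
  rewrite FE -mul_tensor -mulmxDr -Amx_shift /=.
  by rewrite !(addrC _ (_ - _)) !subrK.
rewrite -QR_stretch -dotZl -QR_mul_conormal dot_SO3 // /u !dotDr !dotZr h3.
by rewrite (dotC n t1) (dotC n t2) h13 h23 !mulr0 !add0r mulr1.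
Qed.

Lemma QR_energies W x' : frame_indifferent W -> 0 < x' ->
  W @` fibre F n x' =
  [set W (Amx t1 t2 n x' y z pq.1 pq.2 r) | pq in [set: R * R]].
Proof.
move=> Wf x'0; have [SQ x0 y0 z0 FE] := QR.
have Wf' p' q' : W (Q *m Amx t1 t2 n x' y z p' q' r) = W (Amx t1 t2 n x' y z p' q' r).
  by apply: Wf => //; rewrite /GLplus /= det_Amx // !mulr_gt0.
rewrite QR_fibre //; apply/seteqP; split=> [_ [_ [pq _ <-] <-]|_ [pq _ <-]].
  by exists pq; rewrite // Wf'.
by exists (Q *m Amx t1 t2 n x' y z pq.1 pq.2 r); [exists pq | rewrite Wf'].
Qed.

Lemma QR_reduced_energy W : frame_indifferent W ->
  (if Astar W t1 t2 n y z r <= x then min_stretch_shear W t1 t2 n y z r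
   else min_shear W t1 t2 n x y z r) = intrinsic_Wd W F n.
Proof.
move=> Wf; have [_ x0 _ _ _] := QR; rewrite /intrinsic_Wd -QR_stretch.
rewrite (@eq_reduced_energy _ (fun x' =>
  [set W (Amx t1 t2 n x' y z pq.1 pq.2 r) | pq in [set: R * R]])) //; last first.
  by move=> x'; exact: QR_energies.
rewrite /reduced_energy /Astar /min_stretch_shear /min_shear.
congr (if least _ <= _ then least _ else least _); apply/seteqP; split.
- move=> x' [p' [q' [x'0 mn]]]; split=> //.
  exists (W (Amx t1 t2 n x' y z p' q' r)); first by exists (p', q').
  by move=> y' y'0 _ [pq _ <-]; exact: mn.
- move=> x' [x'0 [_ [[p' q'] _ <-] mn]]; exists p', q'; split=> // x'' p'' q'' x''0.
  exact: (mn x'' x''0 _ (ex_intro2 _ _ (p'', q'') I erefl)).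
- by move=> _ [x' [p' [q' [x'0 ->]]]]; exists x'; [exact: x'0 | exists (p', q')].
- by move=> _ [x' x'0 [[p' q'] _ <-]]; exists x', p', q'.
- by move=> _ [p' [q' ->]]; exists (p', q').
- by move=> _ [[p' q'] _ <-]; exists p', q'.
Qed.

End Decomposition.

(** * Existence of the QR decomposition and evaluation of [Wd] *)

Lemma normalize_dot a : a <> 0 ->
  0 < Num.sqrt (dot a a) /\
  exists2 u, a = Num.sqrt (dot a a) *: u & dot u u = 1.
Proof.
move=> a0; have s0 : 0 < Num.sqrt (dot a a).
  rewrite sqrtr_gt0 lt_neqAle dot_ge0 andbT eq_sym.
  by apply/eqP => /dot_eq0.
split=> //; exists ((Num.sqrt (dot a a))^-1 *: a).
  by rewrite scalerA mulfV ?scale1r ?gt_eqF.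
rewrite dotZl dotZr mulrA -expr2 exprVn sqr_sqrtr ?dot_ge0 // mulVf //.
by apply: contraTneq s0 => ->; rewrite sqrtr0 ltxx.
Qed.

Lemma GLplus_mulv_inj F u v : GLplus F -> F *m u = F *m v -> u = v.
Proof. by move=> /GLplus_unit /mulKmx FK /(congr1 (mulmx (invmx F))); rewrite !FK. Qed.

(* Gram-Schmidt on F t1, F t2, completed by the unit conormal. *)
Lemma QR_exists t1 t2 n F : orthonormal_basis t1 t2 n -> GLplus F ->
  exists Q x y z p q r, QR_decomposition t1 t2 n F Q x y z p q r.
Proof.
move=> onb F0; have [[h1 h2 h3] [h12 h13 h23]] := onb.
have dot0 a : dot a 0 = 0 by rewrite dotE mulmx0 mxE.
have ft1 : F *m t1 <> 0.
  rewrite -(mulmx0 _ F) => /(GLplus_mulv_inj F0) E; move: h1.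
  by rewrite E dot0 => /eqP; rewrite eq_sym oner_eq0.
have [y0 [q1 f1E q11]] := normalize_dot ft1.
set y := Num.sqrt _ in y0 f1E.
pose r := dot q1 (F *m t2).
(* Otherwise F t2 would be a multiple of F t1, and by injectivity of F, t2 a multiple of t1. *)
have f2 : F *m t2 - r *: q1 <> 0.
  move/subr0_eq.
  have -> : r *: q1 = F *m ((r / y) *: t1).
    by rewrite -scalemxAr f1E scalerA divfK ?gt_eqF.
  move/(GLplus_mulv_inj F0) => E; move: h2.
  by rewrite {1}E dotZl h12 mulr0 => /eqP; rewrite eq_sym oner_eq0.
have [z0 [q2 f2E q22]] := normalize_dot f2.
set z := Num.sqrt _ in z0 f2E.
have {}f2E : F *m t2 = r *: q1 + z *: q2 by rewrite -f2E addrC subrK.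
have q12 : dot q1 q2 = 0.
  (* Pairing [f2E] with [q1] gives r = r + z (q1 . q2), and z > 0. *)
  have : r = dot q1 (F *m t2) by [].
  rewrite f2E dotDr !dotZr q11 mulr1 -[LHS]addr0 => /addrI/esym/eqP.
  by rewrite mulf_eq0 gt_eqF //= => /eqP.
pose x := normal_stretch F n.
have x0 : 0 < x by exact: normal_stretch_gt0.
(* Since F^T [q3] = x n, this unit vector is orthogonal to F t1 and F t2, hence to [q1] and [q2]. *)
pose q3 := x *: conormal F n.
have q3F v : dot q3 (F *m v) = x * dot n v.
  by rewrite dotZl dot_adj tr_mul_conormal.
have q33 : dot q3 q3 = 1.
  by rewrite dotZl dotZr mulrA -expr2 normal_stretch_sqr.
have q31 : dot q3 q1 = 0.
  have /eqP := q3F t1; rewrite f1E dotZr (dotC n) h13 mulr0.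
  by rewrite mulf_eq0 gt_eqF //= => /eqP.
have q32 : dot q3 q2 = 0.
  have /eqP := q3F t2; rewrite f2E dotDr !dotZr q31 (dotC n) h23 !mulr0 add0r.
  by rewrite mulf_eq0 gt_eqF //= => /eqP.
have onq : orthonormal_basis q1 q2 q3 by split; split; rewrite // dotC.
pose p := dot q1 (F *m n); pose q := dot q2 (F *m n).
(* The isometry carrying (t1, t2, n) to (q1, q2, q3). *)
pose Q := tensor q1 t1 + tensor q2 t2 + tensor q3 n.
have Qt1 : Q *m t1 = q1.
  rewrite !mulmxDl !tensor_mulv h1 (dotC t2) (dotC n) h12 h13.
  by rewrite !scale0r scale1r !addr0.
have Qt2 : Q *m t2 = q2.
  rewrite !mulmxDl !tensor_mulv h2 h12 (dotC n) h23.
  by rewrite !scale0r scale1r addr0 add0r.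
have Qn : Q *m n = q3.
  by rewrite !mulmxDl !tensor_mulv h3 h13 h23 !scale0r scale1r !add0r.
have FE : F = Q *m Amx t1 t2 n x y z p q r.
  rewrite /Amx !mulmxDr -!scalemxAr !mul_tensor Qt1 Qt2 Qn.
  rewrite -[LHS]mulmx1 -(onb_resolution onb) !mulmxDr !mul_tensor f1E f2E.
  (* The [q3]-component of F n is exactly x, so the coefficient A_nn comes out right. *)
  rewrite (onb_expand (F *m n) onq) q3F h3 mulr1 -/p -/q.
  apply/matrixP => i j; do 4! rewrite ?mxE ?big_ord_recl ?big_ord0 /=; ring.
have QTQ : Q^T *m Q = 1%:M.
  rewrite {2}/Q !mulmxDr !mul_tensor -(onb_resolution onb).
  have -> : Q^T *m q1 = t1.
    rewrite /Q !linearD /= !tr_tensor !mulmxDl !tensor_mulv q11 q31 (dotC q2) q12.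
    by rewrite !scale0r scale1r !addr0.
  have -> : Q^T *m q2 = t2.
    rewrite /Q !linearD /= !tr_tensor !mulmxDl !tensor_mulv q22 q32 q12.
    by rewrite !scale0r scale1r addr0 add0r.
  have -> // : Q^T *m q3 = n.
  rewrite /Q !linearD /= !tr_tensor !mulmxDl !tensor_mulv q33.
  by rewrite (dotC q1) (dotC q2) q31 q32 !scale0r scale1r !add0r.
exists Q, x, y, z, p, q, r; split=> //; split=> //.
(* Orthogonality leaves det Q = 1 or -1; positivity of det F and of x y z selects 1. *)
have : 0 < \det Q.
  move: (F0); rewrite /GLplus /= {1}FE det_mulmx det_Amx //.
  by rewrite pmulr_lgt0 // !mulr_gt0.
have /eqP := congr1 determinant QTQ.
rewrite det_mulmx det_tr det1 -expr2 sqrf_eq1 => /orP[/eqP//|/eqP->].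
by rewrite oppr_gt0 ltr10.
Qed.

(** Every QR decomposition yields the same intrinsic value and at least one exists, so [get] is
    applied to a singleton. *)
Lemma Wd_intrinsic t1 t2 n F W : orthonormal_basis t1 t2 n -> GLplus F ->
  frame_indifferent W -> Wd W t1 t2 F n = intrinsic_Wd W F n.
Proof.
move=> onb F0 Wf; rewrite /Wd; set S := (X in get X).
have -> : S = [set intrinsic_Wd W F n].
  apply/seteqP; split=> w /=.
    move=> [Q [x [y [z [p [q [r [QR ->]]]]]]]].
    by rewrite (QR_reduced_energy onb F0 QR Wf).
  move=> ->; have [Q [x [y [z [p [q [r QR]]]]]]] := QR_exists onb F0.
  exists Q, x, y, z, p, q, r; split=> //.
  by rewrite (QR_reduced_energy onb F0 QR Wf).
exact: get_unique.
Qed.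

(** * Equivariance of the basis-free formula *)

Lemma intrinsic_Wd_opp W F n : intrinsic_Wd W F (- n) = intrinsic_Wd W F n.
Proof.
have cN m : conormal F (- m) = - conormal F m by rewrite /conormal mulmxN.
have dN a b : dot (- a) (- b) = dot a b.
  by apply: eq_bigr => i _; rewrite !mxE mulrNN.
have hN m : normal_stretch F (- m) = normal_stretch F m.
  by rewrite /normal_stretch cN dN.
have sub m x : fibre F m x `<=` fibre F (- m) x.
  move=> G [G0 [v GE vE]]; split; first exact: G0.
  (* Negating both factors preserves v (x) n, and the conormal changes sign with n, so the
     constraint on v is preserved too. *)
  exists (- v).
    by rewrite GE /tensor linearN /= mulmxN mulNmx opprK.
  by rewrite hN cN dN.
rewrite /intrinsic_Wd hN; congr reduced_energy; apply/funext => x.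
(* The reverse inclusion is [sub] applied to -n. *)
by congr image; apply/seteqP; split=> //; rewrite -{2}[n]opprK.
Qed.

Lemma conormal_mul Q F n : SO3 Q -> GLplus F -> conormal (Q *m F) n = Q *m conormal F n.
Proof.
move=> SQ F0; apply/esym/conormal_uniq.
  by rewrite /GLplus /= det_mulmx SQ.2 mul1r.
by rewrite trmx_mul -mulmxA (mulmxA Q^T) SQ.1 mul1mx tr_mul_conormal.
Qed.

(** Perturbation and conormal rotate together, v to Q v, so their inner product and the stretch are
    unchanged. *)
Lemma fibre_mul Q F n x : SO3 Q -> GLplus F ->
  fibre (Q *m F) n x = mulmx Q @` fibre F n x.
Proof.
move=> SQ F0.
have hQ : normal_stretch (Q *m F) n = normal_stretch F n.
  by rewrite /normal_stretch conormal_mul // dot_SO3.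
apply/seteqP; split=> [G [G0 [v GE]]|_ [G [G0 [v GE vE]] <-]].
  have vQ : v = Q *m (Q^T *m v) by rewrite mulmxA SO3_mulTr ?mul1mx.
  have {}GE : G = Q *m (F + tensor (Q^T *m v) n).
    by rewrite mulmxDr mul_tensor -vQ.
  rewrite hQ conormal_mul // [in dot _ _]vQ dot_SO3 // => vE.
  exists (F + tensor (Q^T *m v) n); last by [].
  split; first by move: G0; rewrite GE det_mulmx SQ.2 mul1r.
  by exists (Q^T *m v).
split; first by rewrite det_mulmx SQ.2 mul1r.
exists (Q *m v); first by rewrite GE mulmxDr mul_tensor.
by rewrite hQ conormal_mul // dot_SO3.
Qed.

Lemma intrinsic_Wd_mul W Q F n : frame_indifferent W -> SO3 Q -> GLplus F ->
  intrinsic_Wd W (Q *m F) n = intrinsic_Wd W F n.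
Proof.
move=> Wf SQ F0; rewrite /intrinsic_Wd.
have -> : normal_stretch (Q *m F) n = normal_stretch F n.
  by rewrite /normal_stretch conormal_mul // dot_SO3.
congr reduced_energy; apply/funext => x; rewrite (fibre_mul n x SQ F0) image_comp.
by apply: eq_imagel => G [G0 _] /=; exact: Wf.
Qed.

(** (F Q^T)^T = Q F^T sends [conormal F n] to Q n. *)
Lemma conormal_mulr Q F n : SO3 Q -> GLplus F ->
  conormal (F *m Q^T) (Q *m n) = conormal F n.
Proof.
move=> SQ F0; apply/esym/conormal_uniq.
  by rewrite /GLplus /= det_mulmx det_tr SQ.2 mulr1.
by rewrite trmx_mul trmxK -mulmxA tr_mul_conormal.
Qed.

(** Here the same v serves on both sides, because v (x) Q n = (v (x) n) Q^T. *)
Lemma fibre_mulr Q F n x : SO3 Q -> GLplus F ->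
  fibre (F *m Q^T) (Q *m n) x = (mulmx^~ Q^T) @` fibre F n x.
Proof.
move=> SQ F0; rewrite /fibre /normal_stretch conormal_mulr //.
have FvE v : F *m Q^T + tensor v (Q *m n) = (F + tensor v n) *m Q^T.
  by rewrite mulmxDl tensor_mul trmxK.
have dQ G : \det (G *m Q^T) = \det G by rewrite det_mulmx det_tr SQ.2 mulr1.
apply/seteqP; split=> [G [G0 [v GE vE]]|_ [G [G0 [v GE vE]] <-]].
  exists (F + tensor v n); last by rewrite GE FvE.
  by split; [rewrite -dQ -FvE -GE | exists v].
by split; [rewrite dQ | exists v; rewrite ?GE ?FvE].
Qed.

Lemma intrinsic_Wd_mulr W Q F n : symmetries W Q -> GLplus F ->
  intrinsic_Wd W (F *m Q^T) (Q *m n) = intrinsic_Wd W F n.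
Proof.
move=> [SQ WQ] F0; rewrite /intrinsic_Wd.
have -> : normal_stretch (F *m Q^T) (Q *m n) = normal_stretch F n.
  by rewrite /normal_stretch conormal_mulr.
congr reduced_energy; apply/funext => x; rewrite (fibre_mulr n x SQ F0) image_comp.
(* The symmetry Q is applied at G Q^T, where it gives W(G Q^T) = W(G Q^T Q) = W(G). *)
apply: eq_imagel => G [G0 _] /=; rewrite -WQ; first by rewrite -mulmxA SQ.1 mulmx1.
by rewrite /GLplus /= det_mulmx det_tr SQ.2 mulr1.
Qed.

End EffectiveEnergy.

Theorem proposition2p4 (R : realType) (t1 t2 n : 'cV[R]_3) (F : 'M[R]_3)
    (W : 'M[R]_3 -> R)
    (onb : orthonormal_basis t1 t2 n)
    (F_pos : GLplus F)
    (W_cont : {within @GLplus R, continuous W})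
    (W_frame : frame_indifferent W)
    (W_growth : blows_up W) :
  (* a *)
  (forall s1 s2 : 'cV[R]_3, orthonormal_basis s1 s2 n ->
     Wd W s1 s2 F n = Wd W t1 t2 F n) /\
  (* b *)
  (forall s1 s2 : 'cV[R]_3, orthonormal_basis s1 s2 (- n) ->
     Wd W t1 t2 F n = Wd W s1 s2 F (- n)) /\
  (* c *)
  (forall Q : 'M[R]_3, SO3 Q ->
     forall s1 s2 : 'cV[R]_3, orthonormal_basis s1 s2 n ->
     Wd W s1 s2 (Q *m F) n = Wd W t1 t2 F n) /\
  (* d *)
  (forall Q : 'M[R]_3, symmetries W Q ->
     forall s1 s2 : 'cV[R]_3, orthonormal_basis s1 s2 (Q *m n) ->
     Wd W s1 s2 (F *m Q^T) (Q *m n) = Wd W t1 t2 F n) /\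
  (* e *)
  (isotropic W ->
     forall Q : 'M[R]_3, SO3 Q ->
     forall s1 s2 : 'cV[R]_3, orthonormal_basis s1 s2 (Q *m n) ->
     Wd W s1 s2 (F *m Q^T) (Q *m n) = Wd W t1 t2 F n).
Proof.
(* Proved first because e) is its special case: isotropy makes every rotation a symmetry. *)
have partd Q : symmetries W Q ->
    forall s1 s2 : 'cV[R]_3, orthonormal_basis s1 s2 (Q *m n) ->
    Wd W s1 s2 (F *m Q^T) (Q *m n) = Wd W t1 t2 F n.
  move=> SQ s1 s2 onb'; rewrite !Wd_intrinsic //; first exact: intrinsic_Wd_mulr.
  by rewrite /GLplus /= det_mulmx det_tr SQ.1.2 mulr1.
split; first by move=> s1 s2 onb'; rewrite !Wd_intrinsic.
split; first by move=> s1 s2 onb'; rewrite !Wd_intrinsic // intrinsic_Wd_opp.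
split.
  move=> Q SQ s1 s2 onb'; rewrite !Wd_intrinsic //; first exact: intrinsic_Wd_mul.
  by rewrite /GLplus /= det_mulmx SQ.2 mul1r.
split=> // isoW Q SQ; apply: partd; by rewrite isoW.
Qed.
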